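(* Let $n\ge1$. The finite representation property holds for the signature $(\langle\ \rangle;,\mathsf A_1,\dots,\mathsf A_n,\sqcup)$ for representation by $n$-ary partial functions and for representation by injective $n$-ary partial functions. That is: every finite algebra of this signature that is representable by $n$-ary partial functions is isomorphic to an algebra of $n$-ary partial functions with a finite base; and every finite algebra of this signature that is representable by injective $n$-ary partial functions is isomorphic to an algebra of $n$-ary partial functions that has a finite base and all of whose elements are injective.
   Context: Fix $n\ge 1$; $i$ ranges over $\{1,\dots,n\}$. The signature has an $(n+1)$-ary operation (composition), written $\langle a_1,\dots,a_n\rangle ; b$ (also $\boldsymbol a; b$), unary operations $\mathsf A_1,\dots,\mathsf A_n$, and a binary operation $\sqcup$. Algebras are nonempty. An $n$-ary partial function on a set $X$ is a set $f\subseteq X^{n+1}$ such that $(\boldsymbol x,y),(\boldsymbol x,z)\in f$ implies $y=z$ (where $\boldsymbol x\in X^n$); it is injective if $(\boldsymbol x,z),(\boldsymbol y,z)\in f$ implies $\boldsymbol x=\boldsymbol y$. An algebra of $n$-ary partial functions of this signature is an algebra whose elements are $n$-ary partial functions, for which there are a set $X$ (the base) and an equivalence relation $E$ on $X$ such that every tuple $(x_1,\dots,x_{n+1})$ in every element lies in $X^{n+1}$ and has pairwise $E$-equivalent entries, and whose operations are $\boldsymbol f; g=\{(\boldsymbol x,z)\in X^{n+1} : \exists \boldsymbol y\in X^n,\ (\boldsymbol x,y_i)\in f_i \text{ for each } i \text{ and } (\boldsymbol y,z)\in g\}$, $\mathsf A_i(f)=\{(\boldsymbol x,x_i)\in X^{n+1}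 : x_1,\dots,x_n \text{ all } E\text{-equivalent and there is no } y\in X \text{ with } (\boldsymbol x,y)\in f\}$, and preferential union: $(f\sqcup g)(\boldsymbol x)$ is $f(\boldsymbol x)$ if $f(\boldsymbol x)$ is defined, $g(\boldsymbol x)$ if $f(\boldsymbol x)$ is undefined but $g(\boldsymbol x)$ is defined, and undefined otherwise. An algebra is representable by (injective) $n$-ary partial functions if it is isomorphic to an algebra of $n$-ary partial functions of the same signature (all of whose elements are injective). *)

(* Defs.v *)
From mathcomp Require Import all_boot.
From mathcomp Require Import boolp classical_sets cardinality.

Set Implicit Arguments.
Unset Strict Implicit.
Unset Printing Implicit Defensive.

Local Open Scope classical_set_scope.

Record algebra (n : nat) := Algebra {
  carrier :> Type;
  carrier_inhabited : inhabited carrier;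
  comp : n.-tuple carrier -> carrier -> carrier;
  antidom : 'I_n -> carrier -> carrier;
  prefunion : carrier -> carrier -> carrier }.

Definition isomorphic (n : nat) (A B : algebra n) : Prop :=
  exists h : A -> B,
    [/\ bijective h,
        forall (a : n.-tuple A) (b : A),
          h (comp a b) = comp [tuple of map h a] (h b),
        forall (i : 'I_n) (a : A), h (antidom i a) = antidom i (h a)
      & forall a b : A, h (prefunion a b) = prefunion (h a) (h b)].

(* X^(n+1) is rendered as X^n * X, so that elements are pairs (x, z). *)
Definition nrel (n : nat) (X : Type) : Type := set (n.-tuple X * X).

Definition is_pfun (n : nat) (X : Type) (f : nrel n X) : Prop :=
  forall (x : n.-tuple X) (y z : X), f (x, y) -> f (x, z) -> y = z.

Definition is_injective (n : nat) (X : Type) (f : nrel n X) : Prop :=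
  forall (x y : n.-tuple X) (z : X), f (x, z) -> f (y, z) -> x = y.

Definition pairwise_equiv (X : Type) (E : X -> X -> Prop) (m : nat)
    (t : m.-tuple X) : Prop :=
  forall i j : 'I_m, E (tnth t i) (tnth t j).

Definition nrel_comp (n : nat) (X : Type) (f : n.-tuple (nrel n X))
    (g : nrel n X) : nrel n X :=
  [set p | exists y : n.-tuple X,
      (forall i : 'I_n, tnth f i (p.1, tnth y i)) /\ g (y, p.2)].

Definition nrel_antidom (n : nat) (X : Type) (E : X -> X -> Prop) (i : 'I_n)
    (f : nrel n X) : nrel n X :=
  [set p | [/\ p.2 = tnth p.1 i, pairwise_equiv E p.1
             & ~ exists y : X, f (p.1, y)]].

Definition nrel_prefunion (n : nat) (X : Type) (f g : nrel n X) : nrel n X :=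
  [set p | f p \/ (~ (exists y : X, f (p.1, y)) /\ g p)].

Record pfun_algebra (n : nat) := PfunAlgebra {
  base : Type;
  base_equiv : base -> base -> Prop;
  base_equivP : RelationClasses.Equivalence base_equiv;
  elements : set (nrel n base);
  elements_nonempty : elements !=set0;
  elements_pfun : forall f, elements f -> is_pfun f;
  elements_equiv : forall f, elements f -> forall x y, f (x, y) ->
    pairwise_equiv base_equiv [tuple of rcons x y];
  elements_comp : forall (f : n.-tuple (nrel n base)) (g : nrel n base),
    (forall i : 'I_n, elements (tnth f i)) -> elements g ->
    elements (nrel_comp f g);
  elements_antidom : forall (i : 'I_n) (f : nrel n base), elements f ->
    elements (nrel_antidom base_equiv i f);
  elements_prefunion : forall f g : nrel n base, elements f -> elements g ->
    elements (nrel_prefunion f g) }.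

Arguments base_equiv {n} p _ _.
Arguments elements {n} p _.

Section AlgebraOfPfunAlgebra.
Variables (n : nat) (P : pfun_algebra n).

(* A set S : set T coerces to the subtype of its members. *)
Let C : Type := elements P.

Lemma pfun_inhabited : inhabited C.
Proof.
by have [f Pf] := elements_nonempty P; split; exact: SigSub (mem_set Pf).
Qed.

Lemma pfun_comp_subproof (f : n.-tuple C) (g : C) :
  nrel_comp [tuple of map val f] (val g) \in elements P.
Proof.
apply/mem_set/elements_comp; last exact: set_mem (valP g).
by move=> i; rewrite tnth_map; exact: set_mem (valP (tnth f i)).
Qed.

Lemma pfun_antidom_subproof (i : 'I_n) (f : C) :
  nrel_antidom (base_equiv P) i (val f) \in elements P.
Proof. exact/mem_set/elements_antidom/(set_mem (valP f)). Qed.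

Lemma pfun_prefunion_subproof (f g : C) :
  nrel_prefunion (val f) (val g) \in elements P.
Proof.
by apply/mem_set/elements_prefunion; [exact: set_mem (valP f)|exact: set_mem (valP g)].
Qed.

Definition algebra_of_pfun_algebra : algebra n :=
  @Algebra n C pfun_inhabited
    (fun f g => SigSub (pfun_comp_subproof f g))
    (fun i f => SigSub (pfun_antidom_subproof i f))
    (fun f g => SigSub (pfun_prefunion_subproof f g)).

End AlgebraOfPfunAlgebra.

Coercion algebra_of_pfun_algebra : pfun_algebra >-> algebra.

Definition injective_algebra (n : nat) (P : pfun_algebra n) : Prop :=
  forall f, elements P f -> is_injective f.

Definition finite_base (n : nat) (P : pfun_algebra n) : Prop :=
  finite_set [set: base P].

Definition representable (n : nat) (A : algebra n) : Prop :=
  exists P : pfun_algebra n, isomorphic A P.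

Definition injectively_representable (n : nat) (A : algebra n) : Prop :=
  exists P : pfun_algebra n, injective_algebra P /\ isomorphic A P.

(* Main.v *)
Require Import Defs.
From mathcomp Require Import all_boot.
From mathcomp Require Import boolp classical_sets cardinality.

Local Open Scope classical_set_scope.

(** The idea is that a single tuple already carries a finite representation.
Let [P] be an algebra of [n]-ary partial functions with finitely many elements,
and let [x] be a tuple of points of its base.  The orbit of [x], that is, the
set of all values [f x] with [f] an element of [P] defined at [x], has at most
as many points as [P] has elements.  Since [P] is closed under composition, the
orbit is closed under every element: [f (g_1 x, ..., g_n x)] is the value at
[x] of [<g_1, ..., g_n> ; f].  For this reason restricting the elements to the
orbit commutes with the operations.  The intermediate tuple of a composition
stays in the orbit, and an element undefined at a tuple inside the orbit is
undefined there in the original base, so antidomain and preferential union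
keep their meaning.

One orbit gives a homomorphic image of [P], perhaps not a faithful one.  So
one takes the disjoint union of the orbits of the tuples in a finite set [T],
where [T] contains, for any two distinct elements, a tuple at which they
differ ([exists_finite_separating]).  Two points of the new base are equivalent
when they lie in the same orbit.  The map [lift], which lets an element act on
each orbit separately, is then a homomorphism ([lift_comp], [lift_antidom],
[lift_prefunion]), and it is one-to-one ([lift_inj]) because every entry [x_i]
of a tuple [x] in the domain of some element lies in the orbit of [x]: it is
the value at [x] of the projection [A_i(0)], where the empty function [0] is an
element of [P] ([empty_element]).

Restriction to an orbit and disjoint union both preserve injectivity, so the
same construction serves for both representation classes. *)

Set Implicit Arguments.
Unset Strict Implicit.

(** * The disjoint union of the orbits of a set of tuples *)

Section Unravelling.
Variables (n : nat) (P : pfun_algebra n).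
Hypothesis n_ge1 : (1 <= n)%N.
Let X := base P.
Let E := @base_equiv n P.

(** The empty function is the term [<A_1(f), ..., A_n(f)> ; f]: the antidomains
of [f] are projections, so this applies [f] to the given tuple, but only where
[f] is undefined. *)
Lemma empty_element : elements P set0.
Proof.
have [f Pf] := elements_nonempty P.
have := elements_comp (f := [tuple nrel_antidom E i f | i < n]) (g := f).
set c := nrel_comp _ _; suff -> : c = set0.
  by apply=> // i; rewrite tnth_mktuple; exact: elements_antidom.
apply/seteqP; split=> // -[x z] [y [xy fyz]].
have yx : y = x.
  apply: eq_from_tnth => i; have := xy i.
  by rewrite tnth_mktuple => -[/= <-].
have := xy (Ordinal n_ge1); rewrite tnth_mktuple => -[_ _]; apply.
by exists z; rewrite /= -yx.
Qed.

Lemma element_args_equiv (f : nrel n X) x z :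
  elements P f -> f (x, z) -> pairwise_equiv E x.
Proof.
move=> Pf fxz i j; have := elements_equiv Pf fxz.
move=> /(_ (widen_ord (leqnSn n) i) (widen_ord (leqnSn n) j)).
by rewrite !(tnth_nth z) /= !nth_rcons size_tuple !ltn_ord.
Qed.

Lemma element_value_equiv (f : nrel n X) x z i :
  elements P f -> f (x, z) -> E (tnth x i) z.
Proof.
move=> Pf fxz; have := elements_equiv Pf fxz.
move=> /(_ (widen_ord (leqnSn n) i) ord_max).
by rewrite !(tnth_nth z) /= !nth_rcons size_tuple !ltn_ord ltnn eqxx.
Qed.

Variable T : set (n.-tuple X).

(** A point [z] in the orbit of a tuple [x] is represented by the pair [(x, z)],
which makes the orbits of different tuples disjoint. *)
Definition orbit_points : nrel n X :=
  [set p | T p.1 /\ exists2 f, elements P f & f p].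

Let Y : Type := set_type orbit_points.

Let root (p : Y) : n.-tuple X := (val p).1.
Let value (p : Y) : X := (val p).2.

Lemma orbit_point_inj (p q : Y) : root p = root q -> value p = value q -> p = q.
Proof.
by move=> e1 e2; apply: val_inj; rewrite [LHS]surjective_pairing
  [RHS]surjective_pairing -/(root p) -/(value p) e1 e2.
Qed.

Definition same_root (p q : Y) : Prop := root p = root q.

Lemma same_root_equiv : RelationClasses.Equivalence same_root.
Proof. by split=> [p|p q|p q r]; rewrite /same_root // => ->. Qed.

Definition lift (f : nrel n X) : nrel n Y :=
  [set q | (forall i, root (tnth q.1 i) = root q.2) /\
           f ([tuple of map value q.1], value q.2)].

(** Orbits are closed under the elements of [P]: if each [ys_i] is [g_i x], then
the value of [f] at [ys] is the value of [<g_1, ..., g_n> ; f] at [x]. *)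
Lemma orbit_closed (ys : n.-tuple Y) x f z :
  (forall i, root (tnth ys i) = x) ->
  elements P f -> f ([tuple of map value ys], z) ->
  exists2 p : Y, root p = x & value p = z.
Proof.
move=> rys Pf fz.
have [Tx [g Pg]] : T x /\ exists g : 'I_n -> nrel n X,
    forall i, elements P (g i) /\ g i (x, value (tnth ys i)).
  split; first by rewrite -(rys (Ordinal n_ge1));
    have [] := set_mem (valP (tnth ys (Ordinal n_ge1))).
  have /choice [g Pg] : forall i, exists g : nrel n X,
      elements P g /\ g (x, value (tnth ys i)).
    move=> i; have [_ [g Pg gy]] := set_mem (valP (tnth ys i)).
    by exists g; rewrite -(rys i) /root /value -surjective_pairing.
  by exists g.
have xz : orbit_points (x, z).
  split=> //; exists (nrel_comp [tuple g i | i < n] f).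
    by apply: elements_comp => // i; rewrite tnth_mktuple; have [] := Pg i.
  exists [tuple of map value ys]; split=> // i.
  by rewrite tnth_mktuple tnth_map; have [] := Pg i.
by exists (SigSub (mem_set xz)).
Qed.

(** Both antidomain and preferential union refer to undefinedness, which would
change if a restriction could lose values; closure of orbits excludes this. *)
Lemma lift_defined (ys : n.-tuple Y) x f :
  (forall i, root (tnth ys i) = x) -> elements P f ->
  (exists p, lift f (ys, p)) <-> (exists z, f ([tuple of map value ys], z)).
Proof.
move=> rys Pf; split=> [[p [_ fp]]|[z fz]]; first by exists (value p).
have [p rp vp] := orbit_closed rys Pf fz.
by exists p; split=> [i|] /=; rewrite ?rp ?vp.
Qed.

Lemma lift_comp (f : n.-tuple (nrel n X)) g :
  (forall i, elements P (tnth f i)) ->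
  lift (nrel_comp f g) = nrel_comp [tuple of map lift f] (lift g).
Proof.
move=> Pf; apply/seteqP; split=> -[ys p] /=.
- move=> [/= rys [w [fw gw]]].
  have /choice [q Pq] : forall i, exists q : Y,
      root q = root p /\ value q = tnth w i.
    by move=> i; have [q] := orbit_closed rys (Pf i) (fw i); exists q.
  exists [tuple q i | i < n]; split=> [i|].
    rewrite tnth_map tnth_mktuple; have [rq vq] := Pq i.
    by split=> [j|] /=; rewrite ?rq ?vq.
  split=> [i|] /=; first by rewrite tnth_mktuple; have [] := Pq i.
  suff -> : [tuple of map value [tuple q i | i < n]] = w by [].
  by apply: eq_from_tnth => i; rewrite tnth_map tnth_mktuple; have [] := Pq i.
- move=> [q [fq [/= rq gq]]]; split=> /= [i|].
    have := fq (Ordinal n_ge1); rewrite tnth_map => -[/= -> _]; exact: rq.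
  exists [tuple of map value q]; split=> // i.
  by rewrite tnth_map; have := fq i; rewrite tnth_map => -[].
Qed.

(** Every point in the orbit of [x] is equivalent to the first entry of [x],
since the entries of a tuple in an element are pairwise equivalent.  So on
tuples drawn from one orbit, the condition that antidomain places on the
equivalence of the entries holds both in the old base and in the new one. *)
Lemma orbit_value_equiv (p q : Y) : root p = root q -> E (value p) (value q).
Proof.
move=> rpq.
have [E_refl E_sym E_trans] := base_equivP P.
have rootE (r : Y) : E (tnth (root r) (Ordinal n_ge1)) (value r).
  have [_ [f Pf fr]] := set_mem (valP r); apply: (element_value_equiv (f := f)) => //.
  by rewrite /root /value -surjective_pairing.
apply: (E_trans _ _ _ _ (rootE q)); rewrite -rpq; apply: E_sym; exact: rootE.
Qed.

Lemma lift_antidom i f : elements P f ->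
  lift (nrel_antidom E i f) = nrel_antidom same_root i (lift f).
Proof.
move=> Pf; apply/seteqP; split=> -[ys p] /=.
- move=> [/= rys [/= vp _ nf]]; split=> /=.
  + by apply: orbit_point_inj; rewrite ?rys // vp tnth_map.
  + by move=> j k; rewrite /same_root !rys.
  + by rewrite (lift_defined rys Pf).
- move=> [/= -> rys nf]; split=> [j|] /=; first exact: rys.
  split=> /=; first by rewrite tnth_map.
    by move=> j k; rewrite !tnth_map; exact/orbit_value_equiv/rys.
  by rewrite -(lift_defined (fun j => rys j i) Pf).
Qed.

Lemma lift_prefunion f g : elements P f ->
  lift (nrel_prefunion f g) = nrel_prefunion (lift f) (lift g).
Proof.
move=> Pf; apply/seteqP; split=> -[ys p] /=.
- move=> [/= rys [fp|[nf gp]]]; [left|right] => //.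
  by split=> //=; rewrite (lift_defined rys Pf).
- move=> [[/= rys fp]|[nf [/= rys gp]]]; split=> //=; [left|right] => //.
  by split=> //; rewrite -(lift_defined rys Pf).
Qed.

Lemma lift_pfun f : is_pfun f -> is_pfun (lift f).
Proof.
move=> ff ys p q [/= rp fp] [/= rq fq]; apply: orbit_point_inj; last exact: ff fp fq.
by rewrite -(rp (Ordinal n_ge1)) rq.
Qed.

Lemma lift_injective f : is_injective f -> is_injective (lift f).
Proof.
move=> fi ys zs p [/= ry fy] [/= rz fz]; apply: eq_from_tnth => i.
apply: orbit_point_inj; first by rewrite ry rz.
by have /(congr1 (fun t => tnth t i)) := fi _ _ _ fy fz; rewrite !tnth_map.
Qed.

Lemma lift_equiv f ys p : lift f (ys, p) ->
  pairwise_equiv same_root [tuple of rcons ys p].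
Proof.
move=> [/= rys _]; suff rp i : root (tnth [tuple of rcons ys p] i) = root p.
  by move=> i j; rewrite /same_root !rp.
rewrite (tnth_nth p) /= nth_rcons size_tuple; case: ltnP => [i_lt|_].
  by rewrite -(rys (Ordinal i_lt)) (tnth_nth p).
by rewrite if_same.
Qed.

Definition lifts : set (nrel n Y) := lift @` elements P.

Lemma lifts_comp (f : n.-tuple (nrel n Y)) g :
  (forall i, lifts (tnth f i)) -> lifts g -> lifts (nrel_comp f g).
Proof.
move=> liftsf [g' Pg <-].
have /choice [k Pk] : forall i, exists k, elements P k /\ lift k = tnth f i.
  by move=> i; have [k] := liftsf i; exists k.
have Pk' i : elements P (tnth [tuple k i | i < n] i).
  by rewrite tnth_mktuple; have [] := Pk i.
exists (nrel_comp [tuple k i | i < n] g'); first exact: elements_comp.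
rewrite lift_comp //; congr nrel_comp; apply: eq_from_tnth => i.
by rewrite tnth_map tnth_mktuple; have [] := Pk i.
Qed.

Definition unravelling : pfun_algebra n.
Proof.
refine (@PfunAlgebra n Y same_root same_root_equiv lifts _ _ _ lifts_comp _ _).
- by exists (lift set0); exists set0 => //; exact: empty_element.
- by move=> _ [f Pf <-]; exact/lift_pfun/(elements_pfun Pf).
- by move=> _ [f Pf <-] ys p; exact: lift_equiv.
- move=> i _ [f Pf <-]; exists (nrel_antidom E i f); last exact: lift_antidom.
  exact: elements_antidom.
- move=> _ _ [f Pf <-] [g Pg <-]; exists (nrel_prefunion f g).
    exact: elements_prefunion.
  exact: lift_prefunion.
Defined.

Lemma unravelling_injective : injective_algebra P -> injective_algebra unravelling.
Proof. by move=> Pinj _ [f Pf <-]; exact/lift_injective/Pinj. Qed.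

Lemma unravelling_finite :
  finite_set (elements P) -> finite_set T -> finite_base unravelling.
Proof.
move=> finP finT; rewrite /finite_base /=.
have /choice [f Pf] : forall p : Y, exists f, elements P f /\ f (root p, value p).
  move=> p; have [_ [f Pf fp]] := set_mem (valP p).
  by exists f; rewrite /root /value -surjective_pairing.
(* A point is determined by its root and any one element leading from the
   root to it. *)
have -> : [set: Y] = (fun p => (root p, f p)) @^-1` (T `*` elements P).
  apply/esym/seteqP; split=> // p _; split=> /=; last by have [] := Pf p.
  by have [] := set_mem (valP p).
apply: finite_preimage; last exact: finite_setX.
move=> p q _ _ [rpq fpq]; apply: orbit_point_inj => //.
have [[Pfq fq] [_ fp]] := (Pf q, Pf p).
by apply: (elements_pfun Pfq) fq; rewrite -rpq -fpq.
Qed.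

Definition separating := forall f g, elements P f -> elements P g ->
  (forall x z, T x -> f (x, z) <-> g (x, z)) -> f = g.

(** If [f] takes the value [z] at [x] in [T], then [x_1, ..., x_n] and [z] are all
points of the orbit of [x], so the lift of [f] retains this value. *)
Lemma lift_inj f g : separating -> elements P f -> elements P g ->
  lift f = lift g -> f = g.
Proof.
move=> sepT.
have lift_sub f' g' x z : T x -> elements P f' -> lift f' = lift g' ->
    f' (x, z) -> g' (x, z).
  move=> Tx Pf fg fxz.
  (* With nothing in its domain, set0 has the full projection as antidomain. *)
  have Pid i : elements P (nrel_antidom E i set0).
    exact/elements_antidom/empty_element.
  have xi i : orbit_points (x, tnth x i).
    split=> //; exists (nrel_antidom E i set0); first exact: Pid.
    by split=> //=; [exact: element_args_equiv Pf fxz|case].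
  have xz : orbit_points (x, z) by split=> //; exists f'.
  pose ys : n.-tuple Y := [tuple SigSub (mem_set (xi i)) | i < n].
  have ysx : [tuple of map value ys] = x.
    by apply: eq_from_tnth => i; rewrite tnth_map tnth_mktuple.
  have : lift f' (ys, SigSub (mem_set xz)).
    by split=> [i|] /=; rewrite ?tnth_mktuple ?ysx.
  by rewrite fg => -[_] /=; rewrite ysx.
move=> Pf Pg fg; apply: sepT => // x z Tx.
by split; apply: lift_sub.
Qed.

Lemma unravelling_isomorphic : separating -> isomorphic P unravelling.
Proof.
move=> sepT.
have lP (f : P) : lift (val f) \in elements unravelling.
  by apply/mem_set; exists (val f) => //; exact: set_mem (valP f).
exists (fun f => SigSub (lP f)); split.
- have /choice [k kK] : forall g : unravelling, exists f : P, lift (val f) = val g.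
    move=> g; have [f Pf fg] := set_mem (valP g).
    by exists (SigSub (mem_set Pf)).
  exists k => [f|g]; last exact/val_inj/kK.
  by apply/val_inj/lift_inj => //; exact: set_mem (valP _).
- move=> a b; apply: val_inj; rewrite /= lift_comp.
    congr nrel_comp; apply: eq_from_tnth => i.
    by rewrite !tnth_map.
  by move=> i; rewrite tnth_map; exact: set_mem (valP _).
- move=> i a; apply: val_inj; apply: lift_antidom; exact: set_mem (valP _).
- move=> a b; apply: val_inj; apply: lift_prefunion; exact: set_mem (valP _).
Qed.

End Unravelling.

(** * Finite algebras *)

Lemma exists_finite_separating (n : nat) (P : pfun_algebra n) :
  finite_set (elements P) ->
  exists2 T : set (n.-tuple (base P)), finite_set T & separating T.
Proof.
move=> finP.
have /choice [D PD] : forall fg : nrel n (base P) * nrel n (base P),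
    exists D : set (n.-tuple (base P)), finite_set D /\
      ((forall x z, D x -> fg.1 (x, z) <-> fg.2 (x, z)) -> fg.1 = fg.2).
  move=> [f g] /=; have [->|fg] := pselect (f = g); first by exists set0.
  have [[x z] fgxz] : exists p, ~ (f p <-> g p).
    by apply/existsNP => fgE; apply: fg; apply/funext => p; exact/propext.
  exists [set x]; split=> [|/(_ x z erefl)]; first exact: finite_set1.
  by move=> /fgxz.
exists (\bigcup_(fg in elements P `*` elements P) D fg).
  apply: bigcup_finite => [|fg _]; first exact: finite_setX.
  by have [] := PD fg.
move=> f g Pf Pg fgE; have [_] := PD (f, g); apply=> x z Dx.
by apply: fgE; exists (f, g).
Qed.

Lemma isomorphic_trans (n : nat) (A B C : algebra n) :
  isomorphic A B -> isomorphic B C -> isomorphic A C.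
Proof.
move=> [h [hbij hc ha hu]] [k [kbij kc ka ku]]; exists (k \o h); split.
- exact: bij_comp.
- move=> a b /=; rewrite hc kc; congr Defs.comp; apply: eq_from_tnth => i.
  by rewrite !tnth_map.
- by move=> i a /=; rewrite ha ka.
- by move=> a b /=; rewrite hu ku.
Qed.

Lemma finite_elements (n : nat) (A : algebra n) (P : pfun_algebra n) :
  finite_set [set: A] -> isomorphic A P -> finite_set (elements P).
Proof.
move=> finA [h [[k _ kK] _ _ _]].
apply: sub_finite_set (finite_image (fun a => val (h a)) finA) => f Pf.
by exists (k (SigSub (mem_set Pf))); rewrite ?kK.
Qed.

Lemma finite_base_copy (n : nat) (P : pfun_algebra n) :
  (1 <= n)%N -> finite_set (elements P) ->
  exists Q : pfun_algebra n, [/\ finite_base Q, isomorphic P Q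
    & injective_algebra P -> injective_algebra Q].
Proof.
move=> n_ge1 finP; have [T finT sepT] := exists_finite_separating finP.
exists (unravelling n_ge1 T); split.
- exact: unravelling_finite.
- exact: unravelling_isomorphic.
- exact: unravelling_injective.
Qed.

Unset Implicit Arguments.
Set Strict Implicit.

Theorem corollary7p5 (n : nat) (n_ge1 : (1 <= n)%N) :
  (forall A : algebra n, finite_set [set: A] -> representable A ->
     exists P : pfun_algebra n, finite_base P /\ isomorphic A P)
  /\
  (forall A : algebra n, finite_set [set: A] -> injectively_representable A ->
     exists P : pfun_algebra n,
       [/\ finite_base P, injective_algebra P & isomorphic A P]).
Proof.
split=> A finA.
- move=> [P AP].
  have [Q [finQ PQ _]] := finite_base_copy n_ge1 (finite_elements finA AP).
  by exists Q; split; last exact: isomorphic_trans PQ.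
- move=> [P [Pinj AP]].
  have [Q [finQ PQ Qinj]] := finite_base_copy n_ge1 (finite_elements finA AP).
  by exists Q; split; [|exact: Qinj|exact: isomorphic_trans PQ].
Qed.
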